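(* Let $G$ be a finitely generated group admitting exponentially many fat bigons. Then $G$ does not coarsely embed into any hyperbolic graph of bounded degree.
   Context: All graphs are connected, have uniformly bounded degree, and are metric spaces with the shortest path metric (edges of length 1). A finitely generated group is regarded as its Cayley graph with respect to some finite symmetric generating set, and properties of the group refer to this graph. For $r\ge 0$, $B_r(x)$ is the closed ball of radius $r$ about $x$, and $N_r(Y)=\{x : d(x,Y)\le r\}$. Let $X$ be a graph with base vertex $x_0$, and let $x$ be a vertex. Given $L\ge 1$ and $s,C\ge 0$, an $(L,s,C)$-bigon at $x$ is a pair of paths $\alpha_1,\alpha_2$ in $X$ from $x_0$ to $x$ such that (1) the length satisfies $l(\alpha_i)\le L\,d(x_0,x)$ for $i=1,2$; (2) with $B=N_C(\{x_0,x\})$, we have $d(\alpha_1\setminus B,\alpha_2\setminus B)>s$ (this holds by convention if one of the two sets is empty). Let $\mathcal B^X(L,s,C)$ be the set of vertices $x$ such that there exists an $(L,s,C)$-bigon at $x$. $X$ has (or admits) exponentially many fat bigons at $x_0$ if there exist constants $s_0,c,L>1$ such that for every $s\ge s_0$ there exists $C$ such that $|\mathcal B^X(L,s,C)\cap B_n(x_0)|\ge c^n$ for infinitely many $n\in\mathbb N$. This property does not depend on the choice of $x_0$. A coarse embedding of a graph $X$ into a graph $Y$, with vertex sets $VX$, $VY$, is a map $f:VX\to VY$ for which there are a constant $K\ge 1$ and a function $\rho:\mathbb N\to\mathbb N$ with $\rho(n)\to\infty$ as $n\to\infty$ such that $\rho(d_X(x,y))\le d_Y(f(x),f(y))\le K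 d_X(x,y)$ for all $x,y\in VX$. A graph is hyperbolic if it is $\delta$-hyperbolic for some $\delta$, i.e. for any geodesic triangle with sides $\gamma_1,\gamma_2,\gamma_3$ one has $\gamma_1\subseteq N_\delta(\gamma_2\cup\gamma_3)$. *)

(* Defs.v *)
From HB Require Import structures.
From mathcomp Require Import all_boot all_order all_algebra.
From mathcomp Require Import boolp classical_sets functions cardinality filter.
From mathcomp Require Import reals.

Set Implicit Arguments.
Unset Strict Implicit.
Unset Printing Implicit Defensive.

Import Order.TTheory GRing.Theory Num.Theory.

Local Open Scope classical_set_scope.
Local Open Scope card_scope.
Local Open Scope ring_scope.

(* A path from x to y is a sequence p of vertices such that x :: p is the     *)
(* list of successive vertices; its length is size p.                         *)
Definition is_walk (V : eqType) (e : rel V) (x y : V) (p : seq V) : Prop :=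
  path e x p /\ last x p = y.

(* [set y | adj x y] #<= `I_D : x has at most D neighbours. *)
Record graph := Graph {
  vert :> choiceType;
  adj : rel vert;
  adj_sym : symmetric adj;
  adj_irr : irreflexive adj;
  graph_connected : forall x y, exists p, is_walk adj x y p;
  graph_bounded_degree :
    exists D : nat, forall x, [set y | adj x y] #<= `I_D }.

Section Metric.
Variables (R : realType) (X : graph).
Implicit Types (x y z : X) (p : seq X).

Lemma dist_ex x y :
  exists n, `[< exists p, is_walk (@adj X) x y p /\ size p = n >].
Proof.
by have [p xyp] := graph_connected x y; exists (size p); apply/asboolP; exists p.
Qed.

Definition dist x y : nat := ex_minn (dist_ex x y).

Definition cball x (n : nat) : set X := [set y | (dist x y <= n)%N].

(* Distances between vertices are integers, so the infimum defining d(x, A)   *)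
(* is attained: d(x, A) <= r iff some element of A is at distance <= r.       *)
Definition nbhd (r : R) (A : set X) : set X :=
  [set x | exists2 y, A y & (dist x y)%:R <= r].

(* d(A, B) > s; vacuously true if A or B is empty. *)
Definition separated (s : R) (A B : set X) : Prop :=
  forall a b, A a -> B b -> s < (dist a b)%:R.

(* Paths, their complements and geodesic triangles are taken at the level of  *)
(* vertices; adding the interior points of edges would only change s, C and   *)
(* delta by additive constants.                                               *)
Definition fat_bigon (x0 : X) (L s C : R) (x : X) (p1 p2 : seq X) : Prop :=
  let B := nbhd C [set x0; x] in
  [/\ is_walk (@adj X) x0 x p1, is_walk (@adj X) x0 x p2,
      (size p1)%:R <= L * (dist x0 x)%:R, (size p2)%:R <= L * (dist x0 x)%:R
    & separated s ([set` x0 :: p1] `\` B) ([set` x0 :: p2] `\` B)].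

Definition bigon_set (x0 : X) (L s C : R) : set X :=
  [set x | exists p1 p2, fat_bigon x0 L s C x p1 p2].

(* r <= |A| *)
Definition card_geR (T : Type) (A : set T) (r : R) : Prop :=
  exists2 k : nat, r <= k%:R & `I_k #<= A.

Definition exp_many_fat_bigons_at (x0 : X) : Prop :=
  exists s0 c L : R, [/\ 1 < s0, 1 < c, 1 < L &
    forall s : R, s0 <= s -> exists2 C : R, 0 <= C &
      infinite_set
        [set n : nat | card_geR (bigon_set x0 L s C `&` cball x0 n) (c ^+ n)]].

Definition exp_many_fat_bigons : Prop :=
  exists x0 : X, exp_many_fat_bigons_at x0.

Definition geodesic x y p : Prop :=
  is_walk (@adj X) x y p /\ size p = dist x y.

Definition delta_hyperbolic (delta : R) : Prop :=
  forall x y z p1 p2 p3,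
    geodesic x y p1 -> geodesic y z p2 -> geodesic z x p3 ->
    [set` x :: p1] `<=` nbhd delta ([set` y :: p2] `|` [set` z :: p3]).

Definition hyperbolic : Prop := exists delta : R, delta_hyperbolic delta.

End Metric.

Definition coarse_embedding (R : realType) (X Y : graph) (f : X -> Y) : Prop :=
  exists (K : R) (rho : nat -> nat),
    [/\ 1 <= K, rho @ \oo --> \oo &
      forall x y : X,
        (rho (dist x y) <= dist (f x) (f y))%N /\
        (dist (f x) (f y))%:R <= K * (dist x y)%:R].

Definition coarsely_embeds (R : realType) (X Y : graph) : Prop :=
  exists f : X -> Y, coarse_embedding R f.

(* Since S is required to be closed under inverses, the subgroup it generates *)
(* is the set of products of words in S.                                      *)
Record sym_gen_set (G : groupType) := SymGenSet {
  gens :> seq G;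
  gens_sym : forall s, s \in gens -> (s^-1)%g \in gens;
  gens_gen : forall g : G,
    exists2 w : seq G, {subset w <= gens} & g = (\big[*%g/1%g]_(s <- w) s)%g }.

Section Cayley.
Variables (G : groupType) (S : sym_gen_set G).

(* Simple graph: a trivial generator does not create loops. *)
Definition cayley_adj : rel G := fun g h => (g != h) && ((g^-1 * h)%g \in gens S).

Lemma cayley_sym : symmetric cayley_adj.
Proof.
have H g h : cayley_adj g h -> cayley_adj h g.
  move=> /andP[ngh /gens_sym]; rewrite invgM invgK /cayley_adj => ->.
  by rewrite eq_sym ngh.
by move=> g h; apply/idP/idP; apply: H.
Qed.

Lemma cayley_irr : irreflexive cayley_adj.
Proof. by move=> g; rewrite /cayley_adj eqxx. Qed.

Lemma cayley_connected g h : exists p, is_walk cayley_adj g h p.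
Proof.
have [w wS] := gens_gen S (g^-1 * h)%g.
elim: w g wS => [|s w IHw] g wS.
  rewrite big_nil => gh; exists [::]; split => //=.
  by rewrite -[h](mulVKg g) gh mulg1.
rewrite big_cons => gh.
have wS' : {subset w <= gens S} by move=> t tw; apply: wS; rewrite inE tw orbT.
have [|p [pp lp]] := IHw (g * s)%g wS'.
  by rewrite invgM -mulgA gh mulKg.
have sS : s \in gens S by apply: wS; rewrite inE eqxx.
have [gs|ngs] := eqVneq g (g * s)%g.
  by exists p; rewrite [in X in is_walk _ X]gs.
exists ((g * s)%g :: p); split => //=.
by rewrite pp andbT /cayley_adj ngs mulKg.
Qed.

Lemma cayley_bounded_degree :
  exists D : nat, forall g, [set h | cayley_adj g h] #<= `I_D.
Proof.
exists (size (gens S)) => g; apply/pcard_leP/injfunPex.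
exists (fun h => index (g^-1 * h)%g (gens S)).
  by move=> h /= /andP[_]; rewrite index_mem.
move=> h k; rewrite !inE /= => /andP[_ hS] /andP[_ kS].
by move=> /(congr1 (nth 1%g (gens S))); rewrite !nth_index // => /mulgI.
Qed.

Definition cayley : graph :=
  Graph cayley_sym cayley_irr cayley_connected cayley_bounded_degree.

End Cayley.

(* Main.v *)
Require Import Defs.
From mathcomp Require Import all_boot all_order all_algebra reals.
From mathcomp Require Import boolp classical_sets cardinality filter.
From mathcomp Require Import zify lra.

(** Let [f : X -> Y] be a coarse embedding of a Cayley graph, or of any connected
graph of bounded degree, into a [delta]-hyperbolic graph of bounded degree, and
consider the images under [f] of the two sides of a fat bigon at a vertex [x] in
the ball of radius [n].

Growth (lemma [escape]).  The fibres of [f] are uniformly bounded and the balls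
of [Y] grow at most exponentially.  So, among [c ^ n] vertices of [X], some [x]
has its image at distance more than [n / j] from that of the base vertex, where
[j] depends on [c] and [Y] only.  This is where exponentially many bigons are needed: a
coarse embedding may contract distances a lot, but at this vertex the images of
the two sides are still chains of length linear in the distance [N] between
their endpoints in [Y].

Hyperbolicity (lemmas [few_far_points] and [chains_meet]).  A chain in [Y] of
length at most [L * N] comes within a distance [D] of most points of a geodesic
of length [N] joining its ends, [D] depending only on [L], [delta] and the size
of the jumps: to pass at distance more than [D] from a given point, a chain
needs a number of steps exponential in [D], taken while its projection to the
geodesic stays close to that point.  Two such chains with the same endpoints
thus come within [D] of a common point, which can be taken far from the
endpoints.  As [D] does not depend on the thickness of the bigon, this
contradicts fatness as soon as [f] keeps points at distance more than the
thickness at distance more than [2 * D]. *)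

Set Implicit Arguments.
Unset Strict Implicit.
Unset Printing Implicit Defensive.

Import Order.TTheory GRing.Theory Num.Theory.

Local Open Scope nat_scope.

(** * The path metric of a graph *)

Lemma geodesic_ex (X : graph) (x y : X) : exists p, geodesic x y p.
Proof.
rewrite /geodesic /dist; case: ex_minnP => n /asboolP[p [xyp <-]] _.
by exists p.
Qed.

Lemma dist_le_size (X : graph) (x y : X) p :
  is_walk (@adj X) x y p -> dist x y <= size p.
Proof.
move=> xyp; rewrite /dist; case: ex_minnP => n _; apply.
by apply/asboolP; exists p.
Qed.

Lemma dist_xx (X : graph) (x : X) : dist x x = 0.
Proof. by apply/eqP; rewrite -leqn0 (@dist_le_size X x x [::]). Qed.

Lemma dist_eq0 (X : graph) (x y : X) : dist x y = 0 -> x = y.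
Proof.
have [p [[_ <-] <-]] := geodesic_ex x y.
by move=> /eqP; rewrite size_eq0 => /eqP ->.
Qed.

Lemma dist_triangle (X : graph) (x y z : X) : dist x z <= dist x y + dist y z.
Proof.
have [p [[pp py] <-]] := geodesic_ex x y.
have [q [[qq qz] <-]] := geodesic_ex y z.
rewrite -size_cat; apply: dist_le_size; split; first by rewrite cat_path pp py.
by rewrite last_cat py.
Qed.

Lemma dist_sym (X : graph) (x y : X) : dist x y = dist y x.
Proof.
suff H (u v : X) : dist u v <= dist v u by apply/eqP; rewrite eqn_leq !H.
have [p [[pp <-] <-]] := geodesic_ex v u.
rewrite -(size_belast v p) -size_rev; apply: dist_le_size; split.
  by rewrite rev_path (eq_path (e' := @adj X)) // => a b; rewrite adj_sym.
by case: p {pp} => //= a p; rewrite rev_cons last_rcons.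
Qed.

Lemma between_sym (X : graph) (x y v : X) :
  dist x v + dist v y = dist x y -> dist y v + dist v x = dist y x.
Proof. by rewrite addnC (dist_sym v y) (dist_sym x v) (dist_sym x y). Qed.

Lemma dist_adj (X : graph) (x y : X) : adj x y -> dist x y <= 1.
Proof. by move=> xy; apply: (@dist_le_size X x y [:: y]); rewrite /is_walk /= xy. Qed.

Lemma dist_mem_geodesic (X : graph) (x y v : X) p :
  geodesic x y p -> v \in x :: p -> dist x v + dist v y = dist x y.
Proof.
move=> [[pp py] sp] vp; case/splitPl: vp pp py sp => p1 p2 v1.
rewrite cat_path last_cat v1 size_cat => /andP[pp1 pp2] py sp.
apply/eqP; rewrite eqn_leq dist_triangle andbT -sp.
by apply: leq_add; apply: dist_le_size.
Qed.

Lemma geodesic_through (X : graph) (x y v : X) :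
  dist x v + dist v y = dist x y -> exists2 p, geodesic x y p & v \in x :: p.
Proof.
move=> vxy; have [p [[pp pv] sp]] := geodesic_ex x v.
have [q [[qq qy] sq]] := geodesic_ex v y.
exists (p ++ q); last by rewrite -cat_cons mem_cat -pv mem_last.
split; last by rewrite size_cat sp sq.
by split; rewrite ?cat_path ?pp ?last_cat pv.
Qed.

Lemma geodesic_line (X : graph) (x y : X) :
  exists g : nat -> X, forall i, i <= dist x y ->
    dist x (g i) = i /\ i + dist (g i) y = dist x y.
Proof.
have [p [[pp py] sp]] := geodesic_ex x y.
exists (fun i => last x (take i p)) => i ip.
have := pp; rewrite -{1}(cat_take_drop i p) cat_path => /andP[pp1 pp2].
set v := last x (take i p) in pp2 *.
have xv : dist x v <= i.
  by rewrite -[leqRHS](size_takel (s := p)) ?sp //; apply: dist_le_size.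
have vy : dist v y <= dist x y - i.
  rewrite -sp -size_drop; apply: dist_le_size; split=> //.
  by rewrite -last_cat cat_take_drop.
by have := dist_triangle x v y; lia.
Qed.

(** * Chains near geodesics in hyperbolic graphs *)

(** Thin triangles with the sides given by their points: [p] lies on some
geodesic from [x] to [y] iff [dist x p + dist p y = dist x y].  The integer
constant allows to stay within integer arithmetic. *)
Definition thin (Y : graph) (d : nat) := forall x y z p : Y,
  dist x p + dist p y = dist x y ->
  exists2 p', dist p p' <= d &
    dist y p' + dist p' z = dist y z \/ dist z p' + dist p' x = dist z x.

Lemma hyperbolic_thin (R : realType) (Y : graph) :
  hyperbolic R Y -> exists d, thin Y d.
Proof.
move=> [delta hY]; exists (Num.truncn delta).+1 => x y z p pxy.
have [w1 g1 pw1] := geodesic_through pxy.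
have [w2 g2] := geodesic_ex y z; have [w3 g3] := geodesic_ex z x.
have [p' p'w le_d] := hY _ _ _ _ _ _ g1 g2 g3 p pw1.
exists p'.
  rewrite -(@ler_nat R); apply: le_trans le_d _.
  by rewrite ltW // Num.Theory.truncnS_gt.
by case: p'w => p'w; [left; apply: dist_mem_geodesic g2 p'w
                     | right; apply: dist_mem_geodesic g3 p'w].
Qed.

(** Bisecting the chain [k] times replaces the geodesic by a single jump, and
each bisection costs one thin triangle: the distance to a chain is at most
logarithmic in its length. *)
Lemma chain_near_geodesic (Y : graph) (d K : nat) (q : nat -> Y) (m : nat) :
    thin Y d -> (forall t, t < m -> dist (q t) (q t.+1) <= K) ->
  forall k a b p, a <= b <= m -> b - a <= 2 ^ k ->
    dist (q a) p + dist p (q b) = dist (q a) (q b) ->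
  exists2 t, a <= t <= b & dist p (q t) <= d * k + K.
Proof.
move=> thinY stepq; elim=> [|k IHk] a b p abm bak pab.
  exists a; first by lia.
  have [ba|ba] : b = a \/ b = a.+1 by rewrite expn0 in bak; lia.
    by move: pab; rewrite ba dist_xx (dist_sym p (q a)); lia.
  by have := stepq a; move: pab; rewrite ba (dist_sym p (q a)); lia.
rewrite expnS in bak.
pose c := minn b (a + 2 ^ k).
have [p' pp' p'c] := thinY _ _ (q c) p pab.
have [t tab tp'] : exists2 t, a <= t <= b & dist p' (q t) <= d * k + K.
  case: p'c => p'c.
    have [|||t ct tp'] := IHk c b p'; [lia|lia| |by exists t => //; lia].
    exact: between_sym.
  have [|||t ct tp'] := IHk a c p'; [lia|lia| |by exists t => //; lia].
  exact: between_sym.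
by exists t => //; have := dist_triangle p p' (q t); rewrite mulnS; lia.
Qed.

(** The function [fun w => dist x w - dist y w] serves as a projection to the
geodesics from [x] to [y].  If [u] and [v] project well to the left and well to
the right of [p], then [p] is close neither to the side from [x] to [u] nor to
the side from [v] to [y], which leaves the geodesics from [u] to [v]. *)
Lemma thin_crossing (Y : graph) (d : nat) (x y p u v : Y) :
    thin Y d -> dist x p + dist p y = dist x y ->
    dist x u + dist p y + (4 * d).+1 <= dist u y + dist x p ->
    dist v y + dist x p + (4 * d).+1 <= dist x v + dist p y ->
  exists2 p', dist p p' <= 2 * d & dist u p' + dist p' v = dist u v.
Proof.
move=> thinY pxy ul vr.
have [p1 pp1 [p1yu|p1ux]] := thinY _ _ u p pxy; last first.
  have := dist_triangle u p1 y; have := dist_triangle p1 p y.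
  have := dist_triangle x p1 p; rewrite (dist_sym p1 p).
  by move: p1ux; rewrite (dist_sym u x) (dist_sym p1 x); lia.
have [p2 p12 [p2uv|p2vy]] := thinY _ _ v p1 p1yu.
  by exists p2 => //; have := dist_triangle p p1 p2; lia.
have := dist_triangle p p1 p2; have := dist_triangle x p2 v.
have := dist_triangle x p p2; have := dist_triangle p p2 y.
by move: p2vy; rewrite (dist_sym v p2); lia.
Qed.

Lemma last_before_first_after (P Q : pred nat) m : P 0 -> Q m ->
  exists a b, [/\ a <= b <= m, P a, Q b &
    forall t, a < t < b -> ~~ P t && ~~ Q t].
Proof.
move=> P0 Qm; have exQ : exists n, Q n by exists m.
case: (ex_minnP exQ) => b Qb minb.
have exP : exists n, P n && (n <= b) by exists 0; rewrite P0.
have bdP n : P n && (n <= b) -> n <= b by case/andP.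
case: (ex_maxnP exP bdP) => a /andP[Pa ab] maxa.
exists a, b; split=> //; first by rewrite ab minb.
move=> t /andP[at_ tb].
apply/andP; split; apply/negP; [move=> Pt | move=> Qt].
  by have := maxa t; rewrite Pt (ltnW tb) => /(_ isT); lia.
by have := minb t Qt; lia.
Qed.

Lemma count_window (P : pred nat) (s : seq nat) A :
    uniq s -> (forall i j, P i -> P j -> i < j + A) ->
  count P s <= A.
Proof.
move=> us PA; rewrite -size_filter.
have [/eqP ->//|] := boolP ([seq i <- s | P i] == [::]); rewrite -has_filter => /hasP[i0 i0s Pi0].
have exP : exists n, P n by exists i0.
case: (ex_minnP exP) => i Pi mini.
rewrite -(size_iota i A); apply: uniq_leq_size; first exact: filter_uniq.
move=> j; rewrite mem_filter => /andP[Pj _].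
by rewrite mem_iota mini //= PA.
Qed.

(** A point of the geodesic at distance more than [2 * d + (d * k + K)] from the
chain forces the chain to spend at least [2 ^ k] steps in a window around it:
the chain must cross the window from left to right, so [thin_crossing] applies
to its ends, and the logarithmic bound of [chain_near_geodesic] makes this
portion long.  Each step of the chain lies in at most [A] windows, and counting
the pairs of a far point and a step in its window gives the bound. *)
Lemma few_far_points (Y : graph) (d K k : nat) (q : nat -> Y) m (g : nat -> Y)
    (s : seq nat) (N := dist (q 0) (q m)) (A := (4 * d).+1)
    (far := fun i => all (fun t => 2 * d + (d * k + K) < dist (g i) (q t))
                         (iota 0 m.+1)) :
    thin Y d -> (forall t, t < m -> dist (q t) (q t.+1) <= K) ->
    (forall i, i <= N -> dist (q 0) (g i) = i /\ i + dist (g i) (q m) = N) ->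
    uniq s -> (forall i, i \in s -> A <= i /\ i + A <= N) ->
  count far s * 2 ^ k <= A * m.
Proof.
move=> thinY stepq gN us sA.
(* The step [t] projects to the left, resp. to the right, of the window of the
   [i]-th point of the geodesic, whose own projection is [2 * i - N]. *)
pose left i t := dist (q 0) (q t) + N + A <= dist (q t) (q m) + 2 * i.
pose right i t := dist (q t) (q m) + 2 * i + A <= dist (q 0) (q t) + N.
pose near i t := ~~ left i t && ~~ right i t.
have far_near i : i \in s -> far i -> 2 ^ k <= count (near i) (iota 0 m).
  move=> /sA[Ai iA] /allP fari.
  have [g0 gm] : dist (q 0) (g i) = i /\ i + dist (g i) (q m) = N by apply: gN; lia.
  have left0 : left i 0 by rewrite /left dist_xx -/N; lia.
  have rightm : right i m by rewrite /right dist_xx -/N; lia.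
  have [a [b [abm la rb ab]]] :=
    @last_before_first_after (left i) (right i) m left0 rightm.
  have [||| p pg pab] := @thin_crossing Y d (q 0) (q m) (g i) (q a) (q b) thinY.
  - by rewrite -/N; lia.
  - by move: la; rewrite /left /A; lia.
  - by move: rb; rewrite /right /A; lia.
  have ba : 2 ^ k < b - a.
    rewrite ltnNge; apply/negP => bak.
    have [t tab pt] := chain_near_geodesic thinY stepq abm bak pab.
    have := fari t; rewrite mem_iota => /(_ ltac:(lia)).
    have := dist_triangle (g i) p (q t); lia.
  (* All the [b - a - 1] times strictly between [a] and [b] lie in the window. *)
  have sub : subseq (iota a.+1 (b - a.+1)) (iota 0 m).
    rewrite (_ : m = a.+1 + ((b - a.+1) + (m - b))); last by lia.
    by rewrite !iotaD add0n; apply: subseq_trans (suffix_subseq _ _); apply: prefix_subseq.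
  apply: leq_trans (leq_count_subseq (near i) sub).
  rewrite (_ : count _ _ = b - a.+1); first by lia.
  rewrite -[RHS](size_iota a.+1); apply/eqP; rewrite -all_count.
  by apply/allP => t; rewrite mem_iota => t_ab; apply: ab; lia.
rewrite -sum1_count big_distrl /= mulnC.
apply: (@leq_trans (\sum_(i <- s | far i) count (near i) (iota 0 m))).
  rewrite [leqLHS]big_seq_cond [leqRHS]big_seq_cond.
  by apply: leq_sum => i /andP[si fi]; rewrite muln1 far_near.
apply: (@leq_trans (\sum_(i <- s) \sum_(t <- iota 0 m) near i t)).
  rewrite big_mkcond; apply: leq_sum => i _; case: ifP => // _.
  by rewrite -sum1_count big_mkcond.
rewrite exchange_big /=.
apply: (@leq_trans (\sum_(t <- iota 0 m) A)); last first.
  by rewrite big_const_seq count_predT size_iota iter_addn_0.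
apply: leq_sum => t _; rewrite -(big_mkcond (near^~ t) (fun=> 1)) sum1_count.
apply: count_window => // i j; rewrite /near /left /right; lia.
Qed.


(** Far points of the geodesic are at most a quarter of all points for each of
the chains, so some point away from the ends is near both.  The bound [D] is
chosen before the distance [Q] to the ends: for a fat bigon, [Q] depends on the
neighbourhood of the ends where the sides may meet, hence on the thickness,
which is itself chosen in terms of [D]. *)
Lemma chains_meet (Y : graph) (d K L : nat) : thin Y d ->
  exists D, forall Q, exists N0, forall (q q' : nat -> Y) (m m' : nat),
    (forall t, t < m -> dist (q t) (q t.+1) <= K) ->
    (forall t, t < m' -> dist (q' t) (q' t.+1) <= K) ->
    q' 0 = q 0 -> q' m' = q m ->
    m <= L * dist (q 0) (q m) -> m' <= L * dist (q 0) (q m) ->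
    N0 <= dist (q 0) (q m) ->
  exists p t t',
    [/\ t <= m, t' <= m', dist p (q t) <= D, dist p (q' t') <= D &
        Q <= dist (q 0) p /\ Q <= dist p (q m)].
Proof.
move=> thinY; pose A := (4 * d).+1; pose k := 4 * (A * L).
(* With [2 ^ k > 4 * (A * L)], the bound of [few_far_points] becomes a quarter
   of the length of the geodesic. *)
pose D := 2 * d + (d * k + K); exists D => Q.
exists (4 * (Q + A)) => q q' m m' stepq stepq' q0 qm mL m'L.
set N := dist (q 0) (q m) in mL m'L * => NQ.
have [g gN] := geodesic_line (q 0) (q m); rewrite -/N in gN.
pose far (r : nat -> Y) l i :=
  all (fun t => D < dist (g i) (r t)) (iota 0 l.+1).
pose s := iota (Q + A) (N.+1 - 2 * (Q + A)).
have sA i : i \in s -> Q + A <= i /\ i + (Q + A) <= N.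
  by rewrite mem_iota; lia.
have few (r : nat -> Y) l :
    (forall t, t < l -> dist (r t) (r t.+1) <= K) -> r 0 = q 0 -> r l = q m ->
    l <= L * N -> 4 * count (far r l) s <= N.
  move=> stepr r0 rl lL.
  have : count (far r l) s * 2 ^ k <= A * l.
    apply: few_far_points => //; rewrite ?r0 ?rl ?iota_uniq // -/N -/A.
    by move=> i /sA; lia.
  have : k < 2 ^ k by exact: ltn_expl.
  rewrite {1}/k; nia.
have : count (predU (far q m) (far q' m')) s < size s.
  have := count_predUI (far q m) (far q' m') s.
  have := few q m stepq erefl erefl mL.
  have := few q' m' stepq' q0 qm m'L.
  rewrite /s size_iota -/s; lia.
rewrite ltn_neqAle -all_count => /andP[/allPn[i /sA[Qi iQ] /= near_i] _].
move: near_i; rewrite negb_or => /andP[/allPn[t + pt] /allPn[t' + pt']].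
rewrite !mem_iota => tm tm'; exists (g i), t, t'.
have [] := gN i; first by lia.
by split=> //; lia.
Qed.

(** * Growth of balls and of fibres *)

(** One counting step serves both purposes: with [r] the adjacency relation it
bounds the growth of balls, with [r] the graph of a map it bounds preimages. *)
Lemma cover_by_steps (T U : choiceType) (r : T -> U -> Prop) (e : nat) :
    (forall y, exists2 s : seq U, size s <= e & forall x, r y x -> x \in s) ->
  forall t : seq T, exists2 s : seq U, size s <= size t * e &
    forall x y, y \in t -> r y x -> x \in s.
Proof.
move=> cover; elim=> [|y t [s ste st]]; first by exists [::].
have [s' s'e s'y] := cover y; exists (s' ++ s).
  by rewrite size_cat mulSn leq_add.
move=> x y'; rewrite inE mem_cat => /orP[/eqP -> /s'y -> //|y't ry'x].
by rewrite (st x y') ?orbT.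
Qed.

Lemma ball_size (X : graph) : exists e, forall (x : X) n,
  exists2 s : seq X, size s <= e.+1 ^ n & forall y, dist x y <= n -> y \in s.
Proof.
have [e eX] := @graph_bounded_degree X; exists e => x.
elim=> [|n [s sn xs]].
  exists [:: x] => // y; rewrite leqn0 => /eqP /dist_eq0 ->.
  by rewrite inE.
have [|s' s's ss'] :=
    @cover_by_steps X X (fun z y => y = z \/ adj z y) e.+1 _ s.
  move=> z; exists (z :: finmap.enum_fset (fset_set [set y | adj z y]%classic)).
    by rewrite ltnS geq_card_fset_set.
  move=> y [->|zy]; first by rewrite mem_head.
  rewrite inE; apply/orP; right.
  rewrite [y \in _]in_fset_set; first exact: mem_set.
  by apply/finite_set_leP; exists e.
exists s'; first by rewrite (leq_trans s's) // expnSr leq_mul2r sn orbT.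
move=> y; have [p [[pp py] sp]] := geodesic_ex x y.
case/lastP: p pp py sp => [_ /= xy _ _|p z].
  by apply: (ss' _ x); [apply: xs; rewrite dist_xx | left].
rewrite rcons_path last_rcons size_rcons => /andP[pp pz] zy <-.
rewrite ltnS => pn; apply: (ss' _ (last x p)); last by right; rewrite -zy.
by apply: xs; apply: leq_trans pn; apply: dist_le_size.
Qed.

Lemma card_le_cover (T : choiceType) (A : set T) k (s : seq T) :
  (`I_k #<= A)%card -> (forall x, A x -> x \in s) -> k <= size s.
Proof.
move=> kA As; have sA : (A `<=` [set` s])%classic by move=> x /As.
have fs : finite_set [set` s] by exact: finite_seq.
apply: leq_trans (leq_card_fset_set fs (card_le_trans kA (subset_card_le sA))) _.
by apply: uniq_leq_size => [|x]; rewrite ?finmap.fset_uniq // in_fset_set ?inE.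
Qed.

Lemma exp_ge_nat (R : realType) (c : R) (b : nat) :
  (1 < c)%R -> exists2 j, 0 < j & (b%:R <= c ^+ j)%R.
Proof.
move=> c1; have bernoulli j : (1 + j%:R * (c - 1) <= c ^+ j)%R.
  elim: j => [|j IHj]; first by rewrite expr0 mul0r addr0.
  have c0 : (0 <= c)%R by lra.
  rewrite exprS -natr1; apply: le_trans (ler_wpM2l c0 IHj).
  have : (0 <= j%:R * (c - 1) ^+ 2 :> R)%R by rewrite mulr_ge0 ?sqr_ge0 ?ler0n.
  by nra.
exists (Num.truncn (b%:R / (c - 1))).+1 => //.
apply: le_trans (bernoulli _).
have : (b%:R / (c - 1) < (Num.truncn (b%:R / (c - 1))).+1%:R)%R.
  exact: Num.Theory.truncnS_gt.
by rewrite ltr_pdivrMr; lra.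
Qed.

(** The points with image in the ball of radius [n / j] number at most a constant
times [e ^ (n / j)], with [e] the growth rate of the balls of [Y]; it
suffices to choose [j] such that [2 * e <= c ^ j]. *)
Lemma escape (R : realType) (X Y : graph) (f : X -> Y) (y0 : Y) (r : nat) (c : R) :
    (forall x x', f x = f x' -> dist x x' <= r) -> (1 < c)%R ->
  exists j n0, forall n (A : set X), n0 <= n -> card_geR A (c ^+ n) ->
    exists2 x, A x & n < j * dist y0 (f x).
Proof.
move=> fibre c1; have [a ballX] := ball_size X; have [b ballY] := ball_size Y.
have fibreX (y : Y) : exists2 s : seq X, size s <= a.+1 ^ r &
    forall x, y = f x -> x \in s.
  have [[x yx]|none] := pselect (exists x, y = f x); last first.
    by exists [::] => // x yx; case: none; exists x.
  have [s sr xs] := ballX x r; exists s => // x' yx'.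
  by apply: xs; apply: fibre; rewrite -yx.
set E := a.+1 ^ r in fibreX.
have [j j0 bj] := exp_ge_nat (2 * b.+1) c1.
exists j, (j * E) => n A nE [k ck kA]; apply: contrapT => noA.
have [t tb yt] := ballY y0 (n %/ j).
have [s st sx] := cover_by_steps fibreX t.
have ks : k <= size s.
  apply: card_le_cover kA _ => x Ax; apply: (sx _ (f x)) => //.
  apply: yt; rewrite leqNgt; apply/negP => far_x; apply: noA; exists x => //.
  by have := ltn_ceil n j0; nia.
have kE : k <= b.+1 ^ (n %/ j) * E.
  by apply: leq_trans ks (leq_trans st _); rewrite leq_mul2r tb orbT.
have : 2 ^ (n %/ j) * b.+1 ^ (n %/ j) <= k.
  rewrite -(@ler_nat R); apply: le_trans ck; rewrite -expnMn natrX.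
  apply: (@le_trans _ _ ((c ^+ j) ^+ (n %/ j))%R).
    by apply: lerXn2r => //; rewrite nnegrE ?ler0n ?exprn_ge0 //; lra.
  rewrite -exprM; apply: ler_weXn2l; first lra.
  by rewrite mulnC leq_trunc_div.
have : E <= n %/ j by rewrite leq_divRL // mulnC.
have : n %/ j < 2 ^ (n %/ j) by exact: ltn_expl.
have : 0 < b.+1 ^ (n %/ j) by rewrite expn_gt0.
by nia.
Qed.

(** * Fat bigons and coarse embeddings *)

(** The order of the choices matters: the growth estimate fixes [j], hence the
linear bound on the image chains and [D]; this determines the thickness [s],
which gives [C], and only then is [n] taken large with respect to [C]. *)
Lemma no_coarse_embedding (R : realType) (X Y : graph) :
  exp_many_fat_bigons R X -> hyperbolic R Y -> ~ coarsely_embeds R X Y.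
Proof.
move=> [x0 [s0 [c [L [s0_gt1 c1 L1 bigons]]]]] /hyperbolic_thin[d thinY].
move=> [f [K [rho [K1 rho_oo fK]]]].
have rho_ge M : exists s, forall n, s <= n -> M <= rho n.
  have [s _ sM] : (\forall n \near \oo, M <= rho n)%classic.
    by apply: (rho_oo [set n | M <= n]%classic); exists M.
  by exists s => n sn; apply: (sM n).
pose Kn := (Num.truncn K).+1; pose Ln := (Num.truncn L).+1.
have KKn : (K <= Kn%:R)%R by rewrite ltW // Num.Theory.truncnS_gt.
have LLn : (L <= Ln%:R)%R by rewrite ltW // Num.Theory.truncnS_gt.
have fKn x y : dist (f x) (f y) <= Kn * dist x y.
  have [_ fxy] := fK x y; rewrite -(@ler_nat R) natrM.
  by apply: le_trans fxy _; rewrite ler_wpM2r.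
have [r rP] := rho_ge 1.
have fibre x x' : f x = f x' -> dist x x' <= r.
  move=> fxx'; have [] := fK x x'; rewrite fxx' dist_xx leqn0 => /eqP rho0 _.
  by rewrite leqNgt; apply/negP => /ltnW /rP; rewrite rho0.
have [j [n0 esc]] := escape (f x0) fibre c1.
have [D meet] := chains_meet Kn (Ln * j) thinY.
have [s1 s1P] := rho_ge (2 * D).+1.
pose s := Num.max s0 (s1%:R : R)%R.
have [|C C0 inf] := bigons s; first by rewrite /s le_max lexx.
pose Cn := (Num.truncn C).+1.
have CCn : (C <= Cn%:R)%R by rewrite ltW // Num.Theory.truncnS_gt.
have [N0 {}meet] := meet (Kn * Cn + D).+1.
have [n [n_ge bign]] : exists n, n0 + j * N0 <= n /\
    card_geR (bigon_set x0 L s C `&` cball x0 n)%classic (c ^+ n)%R.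
  apply: contrapT => nobig; apply: inf.
  apply: (sub_finite_set _ (finite_II (n0 + j * N0))) => n /= bign.
  by rewrite ltnNge; apply/negP => n_ge; apply: nobig; exists n.
have [|x [[p1 [p2 [[pp1 lp1] [pp2 lp2] l1 l2 sep]]]] xn nj] := esc n _ _ bign.
  by lia.
rewrite /cball /= in xn.
have N0x : N0 <= dist (f x0) (f x).
  rewrite leqNgt; apply/negP => /ltnW xN0.
  by have := leq_mul (leqnn j) xN0; move: nj n_ge; clear; lia.
pose q (p : seq X) t := f (nth x0 (x0 :: p) t).
have len (p : seq X) : ((size p)%:R <= L * (dist x0 x)%:R)%R ->
    size p <= Ln * j * dist (f x0) (f x).
  move=> pL; have : size p <= Ln * dist x0 x.
    rewrite -(@ler_nat R) natrM; apply: le_trans pL _.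
    by rewrite ler_wpM2r.
  move/leq_trans; apply; rewrite -mulnA leq_mul2l.
  by rewrite (ltnW (leq_ltn_trans xn nj)) orbT.
have step (p : seq X) : path (@adj X) x0 p ->
    forall t, t < size p -> dist (q p t) (q p t.+1) <= Kn.
  move=> /(pathP x0) pp t /pp /dist_adj xt; apply: leq_trans (fKn _ _) _.
  by rewrite -[leqRHS]muln1 leq_mul2l xt orbT.
have qlast (p : seq X) : last x0 p = x -> q p (size p) = f x.
  by move=> <-; rewrite /q -last_nth.
have [|||||||p [t [t' [tp1 tp2 pt pt' [pQ0 pQx]]]]] :=
  meet (q p1) (q p2) (size p1) (size p2).
- exact: step.
- exact: step.
- by [].
- by rewrite !qlast.
- by rewrite qlast //; apply: len.
- by rewrite qlast //; apply: len.
- by rewrite qlast.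
rewrite qlast // {1}/q /= in pQ0 pQx.
(* The common point lies so deep that the nearby vertices of the sides are
   outside the neighbourhoods of the ends where fatness says nothing. *)
have away v : dist p (f v) <= D -> ~ nbhd C [set x0; x]%classic v.
  move=> pv [w wB /le_trans/(_ CCn)]; rewrite ler_nat => vw.
  have : dist (f v) (f w) <= Kn * Cn.
    by apply: leq_trans (fKn _ _) _; rewrite leq_mul2l vw orbT.
  have := dist_triangle p (f v) (f w); rewrite dist_sym in pQ0.
  by case: wB => ->; move: pv pQ0 pQx; clear; lia.
have far12 : (s < (dist (nth x0 (x0 :: p1) t) (nth x0 (x0 :: p2) t'))%:R)%R.
  by apply: sep; split; first [exact: mem_nth | exact: away].
have [rho12 _] := fK (nth x0 (x0 :: p1) t) (nth x0 (x0 :: p2) t').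
have : (2 * D).+1 <= rho (dist (nth x0 (x0 :: p1) t) (nth x0 (x0 :: p2) t')).
  apply: s1P; rewrite -(@ler_nat R); apply: le_trans (ltW far12).
  by rewrite /s le_max lexx orbT.
have := dist_triangle (q p1 t) p (q p2 t').
rewrite (dist_sym (q p1 t) p) /q; move: pt pt' rho12; rewrite /q.
by clear; lia.
Qed.

Theorem theorem1p1 (R : realType) (G : groupType) (S : sym_gen_set G) :
  exp_many_fat_bigons R (cayley S) ->
  forall Y : graph, hyperbolic R Y -> ~ coarsely_embeds R (cayley S) Y.
Proof. by move=> bigons Y; apply: no_coarse_embedding. Qed.
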